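(* Let $\mathcal T=[\mathbf A,\mathbf B,\mathbf C]_R$ with $\mathbf A\in\mathbb F^{I\times R}$, $\mathbf B\in\mathbb F^{J\times R}$, $\mathbf C\in\mathbb F^{K\times R}$, and let $m:=R-r_{\mathbf C}+2$. Assume that (i) $\max\bigl(\min(k_{\mathbf A},k_{\mathbf B}-1),\ \min(k_{\mathbf A}-1,k_{\mathbf B})\bigr)+k_{\mathbf C}\ge R+1$; (ii) for every $\mathbf d\in\mathrm{range}(\mathbf C^T)$, if $(\mathcal C_m(\mathbf A)\odot\mathcal C_m(\mathbf B))\,\widehat{\mathbf d}^m=\mathbf 0$, then $\widehat{\mathbf d}^m=\mathbf 0$; (iii) $\mathbf A\odot\mathbf B$ has full column rank. Then $r_{\mathcal T}=R$ and the CPD of $\mathcal T$ is unique.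
   Context: $\mathbb F$ is $\mathbb R$ or $\mathbb C$. For matrices $\mathbf A,\mathbf B,\mathbf C$ with $R$ nonzero columns each, $[\mathbf A,\mathbf B,\mathbf C]_R:=\sum_{r=1}^R\mathbf a_r\circ\mathbf b_r\circ\mathbf c_r$ ($\circ$ = outer product). The rank $r_{\mathcal T}$ of a tensor is the minimal number of terms in such a representation; a representation with $R=r_{\mathcal T}$ terms is a canonical polyadic decomposition (CPD). The CPD of a tensor $\mathcal T$ of rank $R$ is unique if $\mathcal T=[\mathbf A,\mathbf B,\mathbf C]_R=[\bar{\mathbf A},\bar{\mathbf B},\bar{\mathbf C}]_R$ implies that there are an $R\times R$ permutation matrix $\mathbf\Pi$ and nonsingular diagonal matrices $\mathbf\Lambda_{\mathbf A},\mathbf\Lambda_{\mathbf B},\mathbf\Lambda_{\mathbf C}$ with $\bar{\mathbf A}=\mathbf A\mathbf\Pi\mathbf\Lambda_{\mathbf A}$, $\bar{\mathbf B}=\mathbf B\mathbf\Pi\mathbf\Lambda_{\mathbf B}$, $\bar{\mathbf C}=\mathbf C\mathbf\Pi\mathbf\Lambda_{\mathbf C}$, $\mathbf\Lambda_{\mathbf A}\mathbf\Lambda_{\mathbf B}\mathbf\Lambda_{\mathbf C}=\mathbf I_R$. $r_{\mathbf M}$ is the rank of a matrix $\mathbf M$; its $k$-rank $k_{\mathbf M}$ is the largest $k$ such that every set of $k$ columns of $\mathbf M$ is linearly independent. $\odot$ is the Khatri-Rao (column-wise Kronecker) product. For $\mathbf M\in\mathbb F^{p\times R}$ the $k$-th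 compound matrix $\mathcal C_k(\mathbf M)$ is the $\binom pk\times\binom Rk$ matrix of all $k\times k$ minors of $\mathbf M$, with row and column index sets ordered lexicographically; it is defined for $k\le\min(p,R)$, and a hypothesis involving compound matrices is understood to include that they are defined. For $\mathbf d=[d_1\ \dots\ d_R]^T$, $\widehat{\mathbf d}^m\in\mathbb F^{\binom Rm}$ is the vector of all products $d_{i_1}\cdots d_{i_m}$, $1\le i_1<\dots<i_m\le R$, in lexicographic order. *)

(* Defs.v *)
From HB Require Import structures.
From mathcomp Require Import all_boot all_order all_fingroup all_algebra.
From mathcomp Require Import reals.
From mathcomp Require Import complex mxtens.

Set Implicit Arguments.
Unset Strict Implicit.
Unset Printing Implicit Defensive.

Import Order.TTheory GRing.Theory Num.Theory.
Local Open Scope ring_scope.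

Variant real_or_complex (RT : realType) : fieldType -> Prop :=
  | IsReal : real_or_complex RT RT
  | IsComplex : real_or_complex RT RT[i]%C.

Definition increasing_tuples (p k : nat) : {set k.-tuplelexi 'I_p} :=
  [set t : k.-tuplelexi 'I_p | sorted ltn (map val (t : k.-tuple 'I_p))].

Lemma card_increasing_tuples (p k : nat) :
  #|increasing_tuples p k| = 'C(p, k).
Proof. exact: card_ltn_sorted_tuples. Qed.

(* The i-th (from 0) k-element subset of 'I_p, listed increasingly; the
   subsets are ordered lexicographically. *)
Definition lex_subset (p k : nat) (i : 'I_('C(p, k))) : k.-tuple 'I_p :=
  Order.enum_val (cast_ord (esym (card_increasing_tuples p k)) i).

Section MatrixNotions.

Variable F : fieldType.

Definition nonzero_cols (p R : nat) (M : 'M[F]_(p, R)) : Prop :=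
  forall r : 'I_R, col r M != 0.

Definition cols_independent (p R : nat) (M : 'M[F]_(p, R)) (S : {set 'I_R}) :
    bool :=
  row_free (colsub (@enum_val _ (mem S)) M)^T.

(* The range k <= R matters: for k > R there is no set of k columns, and the
   condition would hold vacuously. *)
Definition k_rank (p R : nat) (M : 'M[F]_(p, R)) : nat :=
  \max_(k < R.+1 |
        [forall S : {set 'I_R}, (#|S| == k) ==> cols_independent M S]) k.

Definition compound_mx (k p R : nat) (M : 'M[F]_(p, R)) :
    'M[F]_('C(p, k), 'C(R, k)) :=
  \matrix_(i, j) \det (mxsub (tnth (lex_subset i)) (tnth (lex_subset j)) M).

Definition khatri_rao (p q R : nat) (A : 'M[F]_(p, R)) (B : 'M[F]_(q, R)) :
    'M[F]_(p * q, R) :=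
  \matrix_(i, r) (col r A *t col r B) i ord0.

(* \widehat{d}^m *)
Definition hat_prod (m R : nat) (d : 'cV[F]_R) : 'cV[F]_('C(R, m)) :=
  \col_i \prod_(k < m) d (tnth (lex_subset i) k) ord0.

End MatrixNotions.

Section Tensors.

Variables (F : fieldType) (I J K : nat).

Definition tensor3 : Type := {ffun 'I_I * 'I_J * 'I_K -> F}.

Definition outer3 (a : 'cV[F]_I) (b : 'cV[F]_J) (c : 'cV[F]_K) : tensor3 :=
  [ffun x => a x.1.1 ord0 * b x.1.2 ord0 * c x.2 ord0].

(* [A, B, C]_R *)
Definition polyadic (R : nat)
    (A : 'M[F]_(I, R)) (B : 'M[F]_(J, R)) (C : 'M[F]_(K, R)) : tensor3 :=
  \sum_(r < R) outer3 (col r A) (col r B) (col r C).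

Definition is_polyadic (T : tensor3) (R : nat)
    (A : 'M[F]_(I, R)) (B : 'M[F]_(J, R)) (C : 'M[F]_(K, R)) : Prop :=
  [/\ nonzero_cols A, nonzero_cols B, nonzero_cols C & T = polyadic A B C].

Definition has_polyadic (T : tensor3) (R : nat) : Prop :=
  exists (A : 'M[F]_(I, R)) (B : 'M[F]_(J, R)) (C : 'M[F]_(K, R)),
    is_polyadic T A B C.

(* r_T = R *)
Definition has_tensor_rank (T : tensor3) (R : nat) : Prop :=
  has_polyadic T R /\ forall R' : nat, has_polyadic T R' -> (R <= R')%N.

Definition cpd_unique (T : tensor3) : Prop :=
  forall R : nat, has_tensor_rank T R ->
  forall (A A' : 'M[F]_(I, R)) (B B' : 'M[F]_(J, R)) (C C' : 'M[F]_(K, R)),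
    is_polyadic T A B C -> is_polyadic T A' B' C' ->
  exists (s : 'S_R) (la lb lc : 'rV[F]_R),
    [/\ [/\ diag_mx la \in unitmx, diag_mx lb \in unitmx
          & diag_mx lc \in unitmx],
        A' = A *m perm_mx s *m diag_mx la,
        B' = B *m perm_mx s *m diag_mx lb,
        C' = C *m perm_mx s *m diag_mx lc
      & diag_mx la *m diag_mx lb *m diag_mx lc = 1%:M].

End Tensors.

(* Main.v *)
Require Import Defs.
From HB Require Import structures.
From mathcomp Require Import all_boot all_order all_fingroup all_algebra.
From mathcomp Require Import reals.
From mathcomp Require Import mxtens zify ring.

Set Implicit Arguments.
Unset Strict Implicit.
Unset Printing Implicit Defensive.

Import Order.TTheory GRing.Theory Num.Theory.
Local Open Scope ring_scope.

(* Contracting the tensor with a vector x in the third mode gives the pencil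
   A Diag(C^T x) B^T, so two decompositions of T have the same pencils. By
   Cauchy-Binet, hypothesis (ii) says that a pencil of rank < m has fewer than m
   nonzero coefficients in C^T x; as k_A, k_B >= m - 1 by (i), its rank is then
   exactly the number of these coefficients. Hence, whenever C'^T x has at most
   m - 1 nonzero entries, C^T x has no more of them than C'^T x, and Kruskal's
   permutation lemma shows that the columns of C' are those of C, up to order
   and scaling.
   Once C' = C, take x orthogonal to a set S of k_C - 1 columns of C but not to
   the r-th one: comparing row spaces of the pencils, the r-th column of B' is a
   combination of the columns of B outside S. Varying S by one exchange and using
   that sufficiently many columns of B are independent leaves only the r-th
   column of B; the scaling of the r-th column of A' follows. *)

(** * The Cauchy-Binet formula and the hypothesis on compound matrices *)

Lemma sorted_ltn_tnth_inj (p k : nat) (t : k.-tuple 'I_p) :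
  sorted ltn (map val t) -> injective (tnth t).
Proof.
move=> st; apply/injectiveP; rewrite /injectiveb /dinjectiveb map_tnth_enum.
apply: (map_uniq (f := val)); exact: (sorted_uniq ltn_trans ltnn st).
Qed.

Lemma lex_subset_in (p k : nat) (i : 'I_('C(p, k))) :
  sorted ltn (map val (lex_subset i)).
Proof.
have := Order.enum_valP (cast_ord (esym (card_increasing_tuples p k)) i).
by rewrite inE.
Qed.

Lemma lex_subset_inj (p k : nat) : injective (@lex_subset p k).
Proof.
rewrite /lex_subset => i j /(@Order.enum_val_inj _ _ (mem (increasing_tuples p k))).
 exact: cast_ord_inj.
Qed.

Lemma lex_subset_imset (p k : nat) :
  [set t : k.-tuple 'I_p | sorted ltn (map val t)] =
  [set lex_subset i | i in [set: 'I_('C(p, k))]].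
Proof.
apply/esym/eqP; rewrite eqEcard card_ltn_sorted_tuples.
rewrite (card_imset _ (@lex_subset_inj p k)) cardsT card_ord leqnn andbT.
by apply/subsetP => t /imsetP[i _ ->]; rewrite inE lex_subset_in.
Qed.

Lemma big_lex_subset (V : nmodType) (p k : nat) (G : k.-tuple 'I_p -> V) :
  \sum_i G (lex_subset i) = \sum_(t : k.-tuple 'I_p | sorted ltn (map val t)) G t.
Proof.
rewrite -[RHS]big_set lex_subset_imset big_imset /=;
  last exact: in2W (@lex_subset_inj _ _).
by apply: eq_bigl => i; rewrite inE.
Qed.

Section CauchyBinet.
Variables (F : fieldType) (m p : nat).
Implicit Types (X : 'M[F]_(m, p)) (Y : 'M[F]_(p, m)).

Lemma det_mulmx_ffun X Y :
  \det (X *m Y) = \sum_(f : {ffun 'I_m -> 'I_p})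
    (\prod_i X i (f i)) * \det (rowsub f Y).
Proof.
rewrite /determinant.
under eq_bigr => s _.
  under eq_bigr => i _ do rewrite mxE.
  rewrite bigA_distr_bigA /= mulr_sumr.
  over.
rewrite exchange_big /=; apply: eq_bigr => f _.
rewrite mulr_sumr; apply: eq_bigr => s _.
by rewrite big_split /= mulrCA; congr (_ * (_ * _));
   apply: eq_bigr => i _; rewrite !mxE.
Qed.

Let sort_ffun (f : {ffun 'I_m -> 'I_p}) : m.-tuple 'I_p :=
  [tuple of sort (relpre val leq) [tuple f i | i < m]].

Lemma sorted_sort_ffun (f : {ffun 'I_m -> 'I_p}) :
  injective f -> sorted ltn (map val (sort_ffun f)).
Proof.
move=> inj_f; rewrite ltn_sorted_uniq_leq; apply/andP; split.
  rewrite (map_inj_uniq val_inj) sort_uniq.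
  by rewrite map_inj_uniq ?enum_uniq.
rewrite sorted_map; apply: sort_sorted => x y; exact: leq_total.
Qed.

Lemma ffun_sort_imset (t : m.-tuple 'I_p) : sorted ltn (map val t) ->
  [set f : {ffun 'I_m -> 'I_p} | injectiveb f & sort_ffun f == t] =
  [set [ffun i => tnth t ((s : 'S_m) i)] | s in [set: 'S_m]].
Proof.
move=> st; have inj_t := sorted_ltn_tnth_inj st.
apply/setP => f; rewrite inE; apply/andP/imsetP => [[inj_f /eqP ft]|[s _ ->]].
  have : perm_eq [tuple f i | i < m] t by rewrite -ft perm_sym perm_sort.
  case/tuple_permP => s fs; exists s => //; apply/ffunP => i; rewrite ffunE.
  have /(congr1 (fun u => nth (f i) u i)) := fs.
  by rewrite -!tnth_nth !tnth_mktuple.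
split.
  by apply/injectiveP => i j; rewrite !ffunE => /inj_t/perm_inj.
apply/eqP/val_inj => /=.
have tr_leq : transitive (relpre val leq : rel 'I_p) by move=> ? ? ?; apply: leq_trans.
have as_leq : antisymmetric (relpre val leq : rel 'I_p).
  by move=> x y /anti_leq/val_inj.
have tot_leq : total (relpre val leq : rel 'I_p) by move=> x y; apply: leq_total.
rewrite -[RHS](sorted_sort (leT := relpre val leq)) //; last first.
  by rewrite -sorted_map; move: st; rewrite ltn_sorted_uniq_leq => /andP[].
apply/perm_sortP => //; apply/tuple_permP; exists s.
by apply: eq_map => i; rewrite ffunE.
Qed.

(** A non-injective [f] repeats a row of [Y] and contributes 0. The other [f] are grouped by their
    sorted values [t]: each is [t] precomposed with a permutation, whose sign completes the Leibniz
    formula for the minor of [X]. *)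
Lemma cauchy_binet X Y :
  \det (X *m Y) = \sum_(t : m.-tuple 'I_p | sorted ltn (map val t))
    \det (colsub (tnth t) X) * \det (rowsub (tnth t) Y).
Proof.
rewrite det_mulmx_ffun (bigID (fun f : {ffun 'I_m -> 'I_p} => injectiveb f)) /=.
rewrite [X in _ + X]big1 ?addr0 => [|f]; last first.
  case/injectivePn => i [j neq_ij eq_fij].
  rewrite (determinant_alternate neq_ij) ?mulr0 // => k.
  by rewrite !mxE eq_fij.
rewrite (partition_big sort_ffun (fun t => sorted ltn (map val t))) /=; last first.
  by move=> f /injectiveP; apply: sorted_sort_ffun.
apply: eq_bigr => t st.
have inj_t := sorted_ltn_tnth_inj st.
rewrite -big_set (ffun_sort_imset st) big_imset /=; last first.
  move=> s1 s2 _ _ /ffunP eq_s; apply/permP => i.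
  by have := eq_s i; rewrite !ffunE => /inj_t.
rewrite [\det (colsub _ _)]/determinant mulr_suml.
apply: eq_big => [s|s _]; first by rewrite inE.
rewrite -mulrA mulrCA; congr (_ * _).
  by apply: eq_bigr => i _; rewrite mxE ffunE.
rewrite (_ : rowsub _ Y = row_perm s (rowsub (tnth t) Y)).
  by rewrite row_permE det_mulmx det_perm.
by apply/matrixP => i j; rewrite !mxE ffunE.
Qed.

End CauchyBinet.

Lemma khatri_raoE (F : fieldType) (p q R : nat) (A : 'M[F]_(p, R))
    (B : 'M[F]_(q, R)) i j r :
  khatri_rao A B (mxtens_index (i, j)) r = A i r * B j r.
Proof.
(* The product of two columns has width [1 * 1]; [tensmxE] needs its column index in paired form. *)
have ord00 : (ord0 : 'I_(1 * 1)) = mxtens_index (ord0 : 'I_1, ord0 : 'I_1).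
  exact: val_inj.
by rewrite mxE ord00 tensmxE !mxE.
Qed.

Section Compound.
Variables (F : fieldType) (p q R m : nat).
Variables (A : 'M[F]_(p, R)) (B : 'M[F]_(q, R)).

Lemma det_mxsub_rank_lt (M : 'M[F]_(p, q)) (f : 'I_m -> 'I_p) (g : 'I_m -> 'I_q) :
  (\rank M < m)%N -> \det (mxsub f g M) = 0.
Proof.
move=> rM; apply/eqP; apply: contraTT rM; rewrite -leqNgt -unitfE => uM.
rewrite -(mxrank_unit (_ : mxsub f g M \in unitmx)) //.
have -> : mxsub f g M = rowsub f 1%:M *m M *m colsub g 1%:M.
  by rewrite -rowsubE mulmx_colsub mulmx1; apply/matrixP => i j; rewrite !mxE.
exact: leq_trans (mxrankM_maxl _ _) (mxrankM_maxr _ _).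
Qed.

(** By Cauchy-Binet the entries of this vector are the minors of order [m] of the pencil, which
    vanish when its rank is below [m]. *)
Lemma compound_hat_prod_eq0 (d : 'cV[F]_R) :
  (\rank (A *m diag_mx d^T *m B^T) < m)%N ->
  khatri_rao (compound_mx m A) (compound_mx m B) *m hat_prod m d = 0.
Proof.
move=> rM; apply/matrixP => ij o; rewrite ord1 {o} [RHS]mxE mxE.
case: (mxtens_indexP ij) => i j.
pose f := tnth (lex_subset i); pose g := tnth (lex_subset j).
apply: etrans (det_mxsub_rank_lt f g rM).
have -> : mxsub f g (A *m diag_mx d^T *m B^T) =
    rowsub f (A *m diag_mx d^T) *m (rowsub g B)^T.
  by rewrite mul_mx_diag; apply/matrixP => k l; rewrite !mxE;
     apply: eq_bigr => r _; rewrite !mxE.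
rewrite cauchy_binet -big_lex_subset; apply: eq_bigr => k _.
rewrite khatri_raoE !mxE.
have -> : colsub (tnth (lex_subset k)) (rowsub f (A *m diag_mx d^T)) =
   mxsub f (tnth (lex_subset k)) A *m diag_mx (\row_l d (tnth (lex_subset k) l) ord0).
  by rewrite !mul_mx_diag; apply/matrixP => a b; rewrite ?mul_mx_diag !mxE.
rewrite det_mulmx det_diag.
rewrite -[\det (rowsub _ (rowsub g B)^T)]det_tr.
have -> : (rowsub (tnth (lex_subset k)) (rowsub g B)^T)^T =
    mxsub g (tnth (lex_subset k)) B.
  by apply/matrixP => a b; rewrite ?mul_mx_diag !mxE.
rewrite mulrAC; congr (_ * _ * _); by apply: eq_bigr => l _; rewrite !mxE.
Qed.

End Compound.

Definition weight (F : fieldType) (R : nat) (d : 'cV[F]_R) : nat :=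
  #|[set r | d r ord0 != 0]|.

Lemma exists_subset_card (T : finType) (E : {set T}) (k : nat) :
  (k <= #|E|)%N -> exists2 S : {set T}, S \subset E & #|S| = k.
Proof.
move=> kE; have : (0 < #|[set S : {set T} | S \subset E & #|S| == k]|)%N.
  by rewrite cards_draws bin_gt0.
by case/card_gt0P => S; rewrite inE => /andP[SE /eqP Sk]; exists S.
Qed.

(** Any [m] indices in the support of [d] would give a nonzero entry of [hat_prod m d]. *)
Lemma hat_prod_eq0_weight (F : fieldType) (R m : nat) (d : 'cV[F]_R) :
  hat_prod m d = 0 -> (weight d < m)%N.
Proof.
move=> d0; rewrite ltnNge; apply/negP => /exists_subset_card[S Sd Sm].
have St : size (enum S) == m by rewrite -cardE Sm.
pose t := Tuple St.
have : t \in [set t : m.-tuple 'I_R | sorted ltn (map val t)].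
  rewrite inE /=.
  have -> : map val (enum S) =
      [seq i <- map val (enum 'I_R) | [exists j : 'I_R, (j \in S) && (val j == i)]].
    rewrite filter_map /enum_mem -filter_predI; congr map; apply: eq_filter => j /=.
    rewrite andbT; apply/idP/existsP => [jS|[k /andP[kS /eqP/val_inj <-]] //].
    by exists j; rewrite jS eqxx.
  apply: sorted_filter; first exact: ltn_trans.
  by rewrite val_enum_ord iota_ltn_sorted.
rewrite lex_subset_imset => /imsetP[i _ ti].
have := congr1 (fun v : 'cV[F]_('C(R, m)) => v i ord0) d0.
rewrite !mxE -ti => /eqP/prodf_eq0[k _].
suff : tnth t k \in S by move/(subsetP Sd); rewrite inE => /negPf->.
by rewrite -mem_enum; apply: mem_tnth.
Qed.

(** * k-rank and the rank of pencils *)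

Section KRank.
Variables (F : fieldType) (p R : nat) (M : 'M[F]_(p, R)).
Implicit Types (S : {set 'I_R}) (v : 'cV[F]_R).

Lemma mulmx_supported S v : (forall r, r \notin S -> v r ord0 = 0) ->
  M *m v = colsub (@enum_val _ (mem S)) M *m rowsub (@enum_val _ (mem S)) v.
Proof.
move=> vS; apply/matrixP => i j; rewrite ord1 !mxE (bigID (mem S)) /=.
rewrite addrC big1 ?add0r => [|r /vS ->]; last by rewrite mulr0.
by rewrite big_enum_val; apply: eq_bigr => k _; rewrite !mxE.
Qed.

Lemma cols_independentP S :
  reflect (forall v, (forall r, r \notin S -> v r ord0 = 0) -> M *m v = 0 -> v = 0)
          (cols_independent M S).
Proof.
apply: (iffP idP) => [freeS v vS|indS].
  rewrite (mulmx_supported vS) => /(congr1 trmx); rewrite trmx_mul trmx0.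
  move=> /eqP; rewrite mulmx_free_eq0 // => /eqP/(congr1 trmx).
  rewrite trmxK trmx0 => v0; apply/matrixP => r j; rewrite ord1 mxE.
  case: (boolP (r \in S)) => [rS|]; last exact: vS.
  have := congr1 (fun u : 'cV_ _ => u (enum_rank_in rS r) ord0) v0.
  by rewrite !mxE enum_rankK_in.
apply: inj_row_free => w w0.
(* Extension of [w] by zero outside [S]. *)
pose v : 'cV[F]_R := \col_r \sum_(k | enum_val k == r) w ord0 k.
have vk k : v (@enum_val _ (mem S) k) ord0 = w ord0 k.
  rewrite mxE (big_pred1 k) // => l; exact: (inj_eq enum_val_inj).
have vS r : r \notin S -> v r ord0 = 0.
  move=> rS; rewrite mxE big1 // => k /eqP ek; case/negP: rS.
  by rewrite -ek; apply: enum_valP.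
have v0 : v = 0.
  apply: indS => //; rewrite (mulmx_supported vS); apply: trmx_inj.
  rewrite trmx_mul trmx0 -[RHS]w0; congr (_ *m _).
  by apply/matrixP => i k; rewrite ord1 mxE [LHS]mxE vk.
by apply/matrixP => i k; rewrite ord1 -vk v0 !mxE.
Qed.

(** The maximum is attained at some [k], since 0 always qualifies. As [k <= R], the set [S] extends
    to one of size [k], and independence passes to subsets. *)
Lemma k_rank_cols_independent S : (#|S| <= k_rank M)%N -> cols_independent M S.
Proof.
pose P (k : 'I_R.+1) := [forall S : {set 'I_R}, (#|S| == k) ==> cols_independent M S].
have P0 : P ord0.
  apply/forallP => U; apply/implyP; rewrite cards_eq0 => /eqP ->.
  apply/cols_independentP => v v0 _; apply/matrixP => r j.
  by rewrite ord1 mxE v0 ?inE.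
have [] := @eq_bigmax_cond _ P (fun k => k : nat).
  by apply/card_gt0P; exists ord0.
move=> k /forallP Pk; rewrite -/(k_rank M) => -> leSk.
have [] := @exists_subset_card _ (~: S) (k - #|S|).
  by rewrite -[#|~: S|](addKn #|S|) cardsC card_ord leq_sub2r // -ltnS.
move=> U US cU.
have cSU : #|S :|: U| == k.
  rewrite cardsU disjoint_setI0 ?cards0 ?subn0 ?cU ?subnKC //.
  by rewrite disjoint_sym disjoints_subset.
have /cols_independentP indSU := implyP (Pk (S :|: U)) cSU.
apply/cols_independentP => v vS; apply: indSU => r.
by rewrite inE negb_or => /andP[/vS].
Qed.

Lemma k_rank_max_vec S v : (#|S| <= k_rank M)%N ->
  (forall r, r \notin S -> v r ord0 = 0) -> M *m v = 0 -> v = 0.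
Proof. by move=> /k_rank_cols_independent/cols_independentP; apply. Qed.

Lemma k_rank_le : (k_rank M <= R)%N.
Proof. by apply/bigmax_leqP => k _; rewrite -ltnS. Qed.

Lemma k_rank_solve S (y : 'I_R -> F) : (#|S| <= k_rank M)%N ->
  exists x : 'cV[F]_p, forall r, r \in S -> (M^T *m x) r ord0 = y r.
Proof.
move=> /k_rank_cols_independent/row_freeP[N MN].
pose z : 'cV[F]_#|S| := \col_k y (enum_val k).
exists (N *m z) => r rS.
have : ((colsub (@enum_val _ (mem S)) M)^T *m (N *m z)) (enum_rank_in rS r) ord0 = y r.
  by rewrite mulmxA MN mul1mx mxE enum_rankK_in.
by rewrite mxE => <-; rewrite mxE; apply: eq_bigr => i _; rewrite !mxE enum_rankK_in.
Qed.

Lemma k_rank_le_rank : (k_rank M <= \rank M)%N.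
Proof.
have [|S _ cS] := @exists_subset_card 'I_R setT (k_rank M).
  by rewrite cardsT card_ord k_rank_le.
have := @k_rank_cols_independent S; rewrite cS => /(_ (leqnn _)).
rewrite /cols_independent /row_free mxrank_tr => /eqP rS.
rewrite -cS -[#|S|]rS.
by rewrite -[X in colsub _ X]mulmx1 -mulmx_colsub mxrankM_maxl.
Qed.

End KRank.

Section Pencil.
Variables (F : fieldType) (p q R : nat) (A : 'M[F]_(p, R)) (B : 'M[F]_(q, R)).
Implicit Types d : 'cV[F]_R.

Lemma pencilE d i j :
  (A *m diag_mx d^T *m B^T) i j = \sum_r d r ord0 * (A i r * B j r).
Proof.
by rewrite mul_mx_diag mxE; apply: eq_bigr => r _; rewrite !mxE mulrAC mulrC.
Qed.

Lemma pencil_supp d (e := @enum_val _ (mem [set r | d r ord0 != 0])) :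
  A *m diag_mx d^T *m B^T =
  colsub e A *m diag_mx (rowsub e d)^T *m (colsub e B)^T.
Proof.
apply/matrixP => i j; rewrite !mul_mx_diag !mxE.
rewrite (bigID (mem [set r | d r ord0 != 0])) /= addrC big1 ?add0r.
  by rewrite big_enum_val; apply: eq_bigr => k _; rewrite !mxE.
by move=> r; rewrite inE negbK !mxE => /eqP ->; rewrite mulr0 mul0r.
Qed.

Lemma rank_pencil_le d : (\rank (A *m diag_mx d^T *m B^T) <= weight d)%N.
Proof. by rewrite pencil_supp -mulmxA; apply: mulmx_max_rank. Qed.

(** Restricted to the support of [d], both outer factors have independent columns and the diagonal
    factor is invertible. *)
Lemma rank_pencil d : (weight d <= k_rank A)%N -> (weight d <= k_rank B)%N ->
  \rank (A *m diag_mx d^T *m B^T) = weight d.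
Proof.
move=> /k_rank_cols_independent freeA /k_rank_cols_independent freeB.
rewrite pencil_supp mxrankMfree // -mxrank_tr trmx_mul mxrankMfree //.
rewrite tr_diag_mx mxrank_unit // unitmxE det_diag unitfE.
apply/prodf_neq0 => k _; rewrite !mxE.
by have := enum_valP k; rewrite inE.
Qed.

End Pencil.

(** * Kruskal's permutation lemma *)

Section Permutation.
Variables (F : fieldType) (K : nat).
Implicit Types L : 'M[F]_K.

Definition rows_in (R : nat) (N : 'M[F]_(R, K)) L : nat :=
  #|[set r | (row r N <= L)%MS]|.

Lemma mulmx_col (p q r : nat) (A : 'M[F]_(p, q)) (B : 'M[F]_(q, r)) j :
  A *m col j B = col j (A *m B).
Proof. by rewrite !colEsub mulmx_colsub. Qed.

Lemma row_mulmx_eq0 (R : nat) (N : 'M[F]_(R, K)) (x : 'cV[F]_K) r :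
  ((N *m x) r ord0 == 0) = (row r N <= kermx x)%MS.
Proof.
rewrite sub_kermx -row_mul; apply/eqP/eqP => [e|].
  by apply/matrixP => i j; rewrite !ord1 !mxE -[RHS]e mxE.
by move/(congr1 (fun M : 'M_1 => M ord0 ord0)); rewrite !mxE.
Qed.

Lemma weight_rows_in (R : nat) (N : 'M[F]_(R, K)) (x : 'cV[F]_K) L :
  (forall r, (row r N <= L)%MS = (row r N <= kermx x)%MS) ->
  (weight (N *m x) + rows_in N L = R)%N.
Proof.
move=> NL; rewrite -[RHS]card_ord -(cardC [set r | (N *m x) r ord0 != 0]).
congr (_ + _)%N; apply: eq_card => r.
by rewrite !inE NL -row_mulmx_eq0 negbK.
Qed.

(** The normal [x] is a column of [cokermx L] that [N] does not annihilate: the intersection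
    contains [L] and is proper in [N], so it has the rank of [L]. *)
Lemma hyperplane_normal (R : nat) (N : 'M[F]_(R, K)) L :
  (L <= N)%MS -> (\rank L + 1 = \rank N)%N ->
  exists x : 'cV[F]_K, (N :&: kermx x == L)%MS.
Proof.
move=> LN rL.
have [j Nj] : exists j, N *m col j (cokermx L) != 0.
  apply/existsP; apply: contraPT rL; rewrite negb_exists => /forallP N0.
  suff /mxrankS : (N <= L)%MS by lia.
  rewrite submxE; apply/eqP/matrixP => i j.
  have := N0 j; rewrite negbK => /eqP/(congr1 (fun v : 'cV_R => v i ord0)).
  by rewrite mulmx_col !mxE.
exists (col j (cokermx L)).
have Lsub : (L <= N :&: kermx (col j (cokermx L)))%MS.
  by rewrite sub_capmx LN sub_kermx mulmx_col mulmx_coker;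
     apply/eqP/matrixP => i k; rewrite !mxE.
rewrite Lsub andbT -(mxrank_leqif_sup Lsub) eqn_leq mxrankS //=.
rewrite -ltnS -[X in (_ < X)%N]addn1 rL.
rewrite ltn_neqAle (mxrank_leqif_sup (capmxSl _ _)) mxrankS ?capmxSl // andbT.
by rewrite sub_capmx submx_refl sub_kermx.
Qed.

Variables (R R' : nat) (N : 'M[F]_(R, K)) (N' : 'M[F]_(R', K)).
Hypothesis weight_le : forall x : 'cV[F]_K,
  (weight (N' *m x) <= R' - \rank N' + 1)%N ->
  (weight (N *m x) <= weight (N' *m x))%N.

(** A vector killed by [N'] has image of weight 0, so the hypothesis makes [N] kill it too. *)
Lemma weight_le_submx : (N <= N')%MS.
Proof.
rewrite submxE; apply/eqP/matrixP => i j.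
pose x := col j (cokermx N').
have w0 (S : nat) : weight (0 : 'cV[F]_S) = 0%N.
  by apply: eq_card0 => r; rewrite inE mxE eqxx.
have N'x : N' *m x = 0.
  by rewrite mulmx_col mulmx_coker; apply/matrixP => a b; rewrite !mxE.
have := @weight_le x; rewrite N'x w0 => /(_ isT); rewrite leqn0 => /eqP/card0_eq/(_ i).
by rewrite !inE mulmx_col !mxE => /negbFE/eqP.
Qed.

(* Descending induction on the rank of L, hyperplanes of the row space of N'
   being the base case. The subspaces <<L + row j N'>> one dimension above L
   meet pairwise in L and there are at least two of them; summing the
   inequalities they satisfy gives the one for L. *)
Lemma rows_in_le k L : (\rank L + k.+1 = \rank N')%N -> (L <= N')%MS ->
  (\rank L <= rows_in N' L)%N -> (rows_in N' L + R <= rows_in N L + R')%N.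
Proof.
elim: k L => [|k IHk] L rL LN' cL.
  have [x /eqmxP defL] := hyperplane_normal LN' rL.
  have eqL S (M : 'M_(S, K)) : (M <= N')%MS ->
    forall r, (row r M <= L)%MS = (row r M <= kermx x)%MS.
    move=> MN' r; rewrite -defL sub_capmx andb_idl // => _.
    exact: submx_trans (row_sub r M) MN'.
  have wN := weight_rows_in (eqL _ _ weight_le_submx).
  have wN' := weight_rows_in (eqL _ _ (submx_refl N')).
  (* [cL] bounds the weight of [N' x] by [R' - \rank L], which is the threshold in [weight_le]. *)
  have := @weight_le x; lia.
(* The canonical form makes equal subspaces equal matrices, so [undup] below keeps each subspace
   once. *)
pose f j := <<(L + row j N')%MS>>%MS.
pose u := undup [seq f j | j <- enum 'I_R' & ~~ (row j N' <= L)%MS].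
have rank_add (v : 'rV_K) : ~~ (v <= L)%MS -> \rank (L + v)%MS = (\rank L).+1.
  move=> vL; apply/eqP; rewrite eqn_leq; apply/andP; split.
    have := rank_leq_row v; have [] := mxrank_adds_leqif L v; lia.
  rewrite ltn_neqAle (mxrank_leqif_sup (addsmxSl _ _)) mxrankS ?addsmxSl // andbT.
  by rewrite addsmx_sub submx_refl.
have uP M : M \in u -> exists2 j, ~~ (row j N' <= L)%MS & M = f j.
  rewrite mem_undup => /mapP[j]; rewrite mem_filter => /andP[jL _] ->; by exists j.
have in_u j : ~~ (row j N' <= L)%MS -> f j \in u.
  by move=> jL; rewrite mem_undup; apply/mapP; exists j;
     rewrite // mem_filter jL mem_enum.
have in_uP S (P : 'M_(S, K)) M i : M \in u -> (row i P <= M)%MS =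
   (row i P <= L)%MS || (~~ (row i P <= L)%MS && (<<(L + row i P)%MS>>%MS == M)).
  move=> /uP[j jL ->]; rewrite genmxE.
  case: (boolP (row i P <= L)%MS) => iL /=.
    by rewrite (submx_trans iL) ?addsmxSl.
  apply/idP/eqP => [iLj|/genmxP/andP[]].
    apply/genmxP; rewrite -(geq_leqif (mxrank_leqif_eq _)) ?addsmx_sub ?addsmxSl //.
    by rewrite !rank_add.
  by rewrite addsmx_sub => /andP[_].
pose n S (P : 'M_(S, K)) M :=
  #|[set i | ~~ (row i P <= L)%MS && (<<(L + row i P)%MS>>%MS == M)]|.
have rows_inE S (P : 'M_(S, K)) M : M \in u -> rows_in P M = (rows_in P L + n S P M)%N.
  move=> uM; rewrite /rows_in /n -cardsUI [X in (_ + X)%N]eq_card0 ?addn0.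
    by apply: eq_card => i; rewrite !inE (in_uP _ _ _ _ uM).
  by move=> i; rewrite !inE; case: (_ <= L)%MS.
have sum_n S (P : 'M_(S, K)) : (\sum_(M <- u) n S P M =
    #|[set i | ~~ (row i P <= L)%MS && (<<(L + row i P)%MS>>%MS \in u)]|)%N.
  rewrite -sum1dep_card [RHS]big_mkcond /=.
  under eq_bigr => M _ do rewrite /n -sum1dep_card big_mkcond /=.
  rewrite exchange_big /=; apply: eq_bigr => i _.
  case: (row i P <= L)%MS => /=; first by rewrite big1.
  rewrite -big_mkcond sum1_count -[RHS]/(nat_of_bool (_ \in u)) -count_uniq_mem
    ?undup_uniq //.
  by apply: eq_count => M; rewrite eq_sym.
have compl S (P : 'M_(S, K)) : (rows_in P L + #|[set i | ~~ (row i P <= L)%MS]| = S)%N.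
  rewrite -[RHS]card_ord -(cardC [set r | (row r P <= L)%MS]); congr (_ + _)%N.
  by apply: eq_card => r; rewrite !inE.
have sumN : (rows_in N L + \sum_(M <- u) n R N M <= R)%N.
  rewrite -[X in (_ <= X)%N](compl R N) leq_add2l sum_n subset_leq_card //.
  by apply/subsetP => i; rewrite !inE => /andP[].
have sumN' : (rows_in N' L + \sum_(M <- u) n R' N' M = R')%N.
  rewrite -[RHS](compl R' N') sum_n; congr (_ + _)%N; apply: eq_card => j.
  rewrite !inE andb_idr //; apply: in_u.
have le_u M : M \in u -> (rows_in N' L + n R' N' M + R <= rows_in N L + n R N M + R')%N.
  move=> uM; rewrite -!rows_inE //; have [j jL defM] := uP M uM.
  apply: IHk.
  - by rewrite defM genmxE rank_add //; lia.
  - by rewrite defM genmxE addsmx_sub LN' row_sub.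
  - rewrite rows_inE // defM genmxE rank_add //.
    suff : (0 < n R' N' M)%N by rewrite defM; lia.
    by apply/card_gt0P; exists j; rewrite inE jL defM eqxx.
have le_sum : (size u * (rows_in N' L + R) + \sum_(M <- u) n R' N' M <=
              size u * (rows_in N L + R') + \sum_(M <- u) n R N M)%N.
  have sizeE (c : nat) : (size u * c = \sum_(M <- u) c)%N.
    by rewrite big_const_seq count_predT iter_addn_0 mulnC.
  rewrite !sizeE -!big_split /= !big_seq; apply: leq_sum => M /le_u.
  by rewrite addnAC [X in (_ <= X)%N -> _]addnAC.
(* With at most one such subspace, all rows of [N'] would lie in rank at most [\rank L + 1], below
   [\rank N']. *)
have size_u : (1 < size u)%N.
  rewrite ltnNge; apply/negP => size_u.
  have [M N'M rM] : exists2 M : 'M_K, (N' <= M)%MS & (\rank M <= (\rank L).+1)%N.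
    case Du: u size_u => [|M u'] size_u.
      exists L => //; apply/row_subP => j; case: (boolP (row j N' <= L)%MS) => // jL.
      by have := in_u j jL; rewrite Du.
    have uM : M \in u by rewrite Du inE eqxx.
    have [j0 j0L defM] := uP M uM.
    exists M; last by rewrite defM genmxE rank_add.
    apply/row_subP => j; rewrite in_uP //; case: (boolP (row j N' <= L)%MS) => //= jL.
    by have := in_u j jL; rewrite Du; case: (u') size_u => //= _; rewrite inE.
  have := leq_trans (mxrankS N'M) rM; lia.
move: le_sum sumN sumN' size_u.
move: (\sum_(M <- u) n R' N' M)%N (\sum_(M <- u) n R N M)%N (size u) => s' s t.
move: (rows_in N' L) (rows_in N L) => a' a le_sum sumN sumN' t_gt1.
(* Cancelling the counts [sumN] and [sumN'] from the summed inequality leaves the claim multiplied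
   by [t - 1 > 0]. *)
suff : ((t - 1) * (a' + R) <= (t - 1) * (a + R'))%N by rewrite leq_pmul2l ?subn_gt0.
nia.
Qed.

End Permutation.

Section PermutationLemma.
Variables (F : fieldType) (K R R' : nat) (N : 'M[F]_(R, K)) (N' : 'M[F]_(R', K)).

Lemma row_neq0_k_rank i : (1 <= k_rank N^T)%N -> row i N != 0.
Proof.
move=> kN; apply/eqP => Ni.
have [x] := @k_rank_solve _ _ _ N^T [set i] (fun=> 1)
  (leq_trans (eq_leq (cards1 i)) kN).
move/(_ i (set11 i)); rewrite trmxK => Nx.
have := congr1 (fun v => (v *m x) ord0 ord0) Ni.
by rewrite -row_mul mxE Nx mul0mx mxE => /eqP; rewrite oner_eq0.
Qed.

Lemma k_rank_line_inj (v : 'rV[F]_K) i1 i2 : (2 <= k_rank N^T)%N ->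
  (row i1 N <= v)%MS -> (row i2 N <= v)%MS -> i1 = i2.
Proof.
move=> kN Ni1 Ni2; apply/eqP; apply/negPn/negP => ni12.
have [|x Nx] := @k_rank_solve _ _ _ N^T [set i1; i2] (fun r => (r == i1)%:R).
  by rewrite cards2 ni12.
have := Nx i2; rewrite trmxK !inE eqxx orbT eq_sym (negPf ni12) => /(_ isT)/eqP.
rewrite row_mulmx_eq0 => Ni2x.
have := row_neq0_k_rank i2 (ltnW kN).
have [a2 defN2] := sub_rVP Ni2; rewrite defN2 scaler_eq0 negb_or => /andP[a2_neq0 _].
have vx : (v <= kermx x)%MS by rewrite -(eqmx_scale _ a2_neq0) -defN2.
have := Nx i1; rewrite trmxK !inE eqxx => /(_ isT)/eqP.
have /eqP -> : (N *m x) i1 ord0 == 0 by rewrite row_mulmx_eq0 (submx_trans Ni1).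
by rewrite eq_sym oner_eq0.
Qed.

(** The counting inequality is applied to the line spanned by each row of [N']. It holds at least
    one row of [N'] and, by the k-rank, at most one row of [N]; with [R' <= R] all these bounds are
    equalities. *)
Lemma permutation_lemma :
  (2 <= k_rank N^T)%N -> (2 <= \rank N')%N -> (R' <= R)%N ->
  (forall j, row j N' != 0) ->
  (forall x : 'cV[F]_K, (weight (N' *m x) <= R' - \rank N' + 1)%N ->
     (weight (N *m x) <= weight (N' *m x))%N) ->
  R' = R /\ exists s : 'I_R' -> 'I_R, injective s /\
    forall j, exists2 a, a != 0 & row j N' = a *: row (s j) N.
Proof.
move=> kN rN' leR'R N'0 wle.
pose L j := <<row j N'>>%MS.
have rowN_le1 j : (rows_in N (L j) <= 1)%N.
  apply/card_le1_eqP => i1 i2; rewrite !inE !genmxE => Ni1 Ni2.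
  exact: k_rank_line_inj kN Ni2 Ni1.
have rowN'_ge1 j : (0 < rows_in N' (L j))%N.
  by apply/card_gt0P; exists j; rewrite inE genmxE.
have le_rows j : (rows_in N' (L j) + R <= rows_in N (L j) + R')%N.
  have rL : \rank (L j) = 1%N by rewrite genmxE rank_rV N'0.
  apply: (rows_in_le wle (k := \rank N' - 2)); rewrite ?rL //.
    by lia.
  by rewrite genmxE row_sub.
have eqR : R' = R.
  have j0 : 'I_R' by apply: (Ordinal (leq_trans (ltnW rN') (rank_leq_row N'))).
  by have := le_rows j0; have := rowN_le1 j0; have := rowN'_ge1 j0; lia.
split=> //.
have [s Ns] : exists s : 'I_R' -> 'I_R, forall j, (row (s j) N <= row j N')%MS.
  apply: (fin_all_exists (P := fun j i => (row i N <= row j N')%MS)) => j.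
  have /card_gt0P[i] : (0 < rows_in N (L j))%N.
    by have := le_rows j; have := rowN'_ge1 j; lia.
  by rewrite inE genmxE; exists i.
have Ns' j : exists2 a, a != 0 & row j N' = a *: row (s j) N.
  have [a def_sj] := sub_rVP (Ns j).
  have := row_neq0_k_rank (s j) (ltnW kN).
  rewrite def_sj scaler_eq0 negb_or => /andP[a0 _].
  by exists a^-1; rewrite ?invr_eq0 // scalerA mulVf ?scale1r.
exists s; split=> // j1 j2 eq_s.
have /card_le1_eqP : (rows_in N' (L j1) <= 1)%N.
  by have := le_rows j1; have := rowN_le1 j1; lia.
apply; rewrite !inE genmxE //.
have [a _ ->] := Ns' j2; rewrite -eq_s.
exact: submx_trans (scalemx_sub _ (submx_refl _)) (Ns j1).
Qed.

End PermutationLemma.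

(** * Uniqueness of the decomposition *)

Section CommonThirdFactor.
Variables (F : fieldType) (p q K R : nat).
Variables (A A' : 'M[F]_(p, R)) (B B' : 'M[F]_(q, R)) (C : 'M[F]_(K, R)).

(** The pencil has rank [weight d], the most that [diag_mx d^T *m B'^T] can have, and lies in the
    row space of that matrix; so the row spaces agree. Row [r] of that matrix is a nonzero multiple
    of column [r] of [B']. *)
Lemma col_in_supp_span (d : 'cV[F]_R) r :
  A *m diag_mx d^T *m B^T = A' *m diag_mx d^T *m B'^T ->
  (weight d <= k_rank A)%N -> (weight d <= k_rank B)%N -> d r ord0 != 0 ->
  exists2 v : 'cV[F]_R, col r B' = B *m v &
    forall s, d s ord0 = 0 -> v s ord0 = 0.
Proof.
move=> eqM dA dB dr.
have rM := rank_pencil dA dB.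
have subM : (A *m diag_mx d^T *m B^T <= diag_mx d^T *m B'^T)%MS.
  by rewrite eqM -mulmxA submxMl.
have rB' := rank_pencil_le 1%:M B' d; rewrite mul1mx in rB'.
have : (row r (diag_mx d^T *m B'^T) <= diag_mx d^T *m B^T)%MS.
  apply: submx_trans (row_sub _ _) (submx_trans _ (submxMl A _)).
  by rewrite mulmxA -(geq_leqif (mxrank_leqif_sup subM)) rM.
have -> : row r (diag_mx d^T *m B'^T) = d r ord0 *: (col r B')^T.
  by rewrite mul_diag_mx; apply/matrixP => i j; rewrite !mxE.
case/submxP => y def_y; exists ((d r ord0)^-1 *: (y *m diag_mx d^T)^T).
  apply: (scalerI dr); rewrite -scalemxAr scalerA divff // scale1r.
  by apply: trmx_inj; rewrite trmx_mul trmxK -mulmxA -def_y linearZ.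
by move=> s ds; rewrite mxE mxE mul_mx_diag mxE [d^T _ _]mxE ds mulr0 mulr0.
Qed.

Hypothesis eq_pencil : forall x : 'cV[F]_K,
  A *m diag_mx (C^T *m x)^T *m B^T = A' *m diag_mx (C^T *m x)^T *m B'^T.
Hypothesis kC : (2 <= k_rank C)%N.
Hypothesis kA : (R + 1 <= k_rank A + k_rank C)%N.
Hypothesis kB : (R + 2 <= k_rank B + k_rank C)%N.
Hypothesis B'0 : nonzero_cols B'.

(** The [k_C] columns indexed by [r |: S] are independent, so a linear form takes prescribed values
    on them; its zeros include the [k_C - 1] indices of [S]. *)
Lemma exists_cocircuit (S : {set 'I_R}) r : r \notin S ->
  #|S| = (k_rank C - 1)%N ->
  exists x : 'cV[F]_K, [/\ (C^T *m x) r ord0 = 1,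
    forall s, s \in S -> (C^T *m x) s ord0 = 0
  & (weight (C^T *m x)%R + k_rank C <= R + 1)%N].
Proof.
move=> rS cS.
have [|x Cx] := @k_rank_solve _ _ _ C (r |: S) (fun s => (s == r)%:R).
  by rewrite cardsU1 rS cS; lia.
have xS s : s \in S -> (C^T *m x) s ord0 = 0.
  move=> sS; rewrite Cx ?inE ?sS ?orbT //.
  by case: eqP => // sr; rewrite -sr sS in rS.
exists x; split=> //; first by rewrite Cx ?inE ?eqxx.
suff : (weight (C^T *m x)%R <= #|~: S|)%N.
  by have := cardsC S; rewrite card_ord cS; lia.
apply/subset_leq_card/subsetP => s; rewrite !inE; apply: contra => sS.
by rewrite xS.
Qed.

Lemma col_in_compl_span (S : {set 'I_R}) r : r \notin S ->
  #|S| = (k_rank C - 1)%N ->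
  exists2 v : 'cV[F]_R, col r B' = B *m v & forall s, s \in S -> v s ord0 = 0.
Proof.
move=> rS cS; have [x [xr xS wx]] := exists_cocircuit rS cS.
have [||| v defv vx] := @col_in_supp_span (C^T *m x) r (eq_pencil x).
- lia.
- lia.
- by rewrite xr oner_neq0.
by exists v => // s /xS; apply: vx.
Qed.

Lemma exists_indep_set r : exists2 S : {set 'I_R}, r \notin S & #|S| = (k_rank C - 1)%N.
Proof.
have [|S Sr cS] := @exists_subset_card _ (~: [set r]) (k_rank C - 1).
  by have := cardsC [set r]; rewrite cards1 card_ord; have := k_rank_le C; lia.
by exists S => //; apply/negP => /(subsetP Sr); rewrite !inE eqxx.
Qed.

(* Exchanging an element of S for s moves the support of the coefficient
   vector by one index only, so that both vectors live on at most k_B columns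
   and coincide; letting s vary, only the r-th coefficient survives. *)
Lemma second_factor_col r :
  exists2 b, b != 0 & col r B' = b *: col r B.
Proof.
have [S rS cS] := exists_indep_set r.
have [v defv vS] := col_in_compl_span rS cS.
have v0 s : s != r -> v s ord0 = 0.
  move=> sr; case: (boolP (s \in S)) => [/vS //|sS].
  have [t tS] : exists t, t \in S by apply/card_gt0P; lia.
  pose S2 := s |: (S :\ t).
  have cSt : #|S :\ t| = (k_rank C - 2)%N by have := cardsD1 t S; rewrite tS; lia.
  have rS2 : r \notin S2 by rewrite !inE negb_or eq_sym sr negb_and rS orbT.
  have cS2 : #|S2| = (k_rank C - 1)%N.
    by rewrite cardsU1 !inE (negPf sS) andbF cSt; lia.
  have [v2 defv2 v2S] := col_in_compl_span rS2 cS2.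
  (* The complement of [S :\ t] has [R - k_C + 2] elements, exactly the size that [kB] allows. *)
  have : v - v2 = 0.
    apply: (@k_rank_max_vec _ _ _ B (~: (S :\ t))).
    - by have := cardsC (S :\ t); rewrite card_ord cSt; lia.
    - move=> i; rewrite inE negbK => iSt; rewrite mxE [(- v2) _ _]mxE.
      rewrite vS ?v2S ?subr0 //; first by rewrite inE iSt orbT.
      by move: iSt; rewrite inE => /andP[].
    - by rewrite mulmxBr -defv -defv2 subrr.
  move/eqP; rewrite subr_eq0 => /eqP ->; apply: v2S.
  by rewrite !inE eqxx.
have defB : col r B' = v r ord0 *: col r B.
  rewrite defv; apply/matrixP => i j; rewrite ord1 mxE (bigD1 r) //= big1 ?addr0.
    by rewrite !mxE mulrC.
  by move=> s sr; rewrite v0 ?mulr0.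
exists (v r ord0) => //; apply/eqP => vr.
by have := B'0 r; rewrite defB vr scale0r eqxx.
Qed.

(** With [B'] known up to scaling, equality of the pencils is a relation between the columns of [B]
    in the support of [d]. These are independent, so its coefficients vanish; the [r]-th one
    compares the columns of [A] and [A']. *)
Lemma common_third_factor r :
  exists b, [/\ b != 0, col r B' = b *: col r B & col r A = b *: col r A'].
Proof.
have [b0 b_neq0] : exists b : 'I_R -> F, forall s,
    b s != 0 /\ col s B' = b s *: col s B.
  apply: (fin_all_exists (P := fun s bs => bs != 0 /\ col s B' = bs *: col s B)) => s.
  by have [b b0 defB] := second_factor_col s; exists b.
exists (b0 r); have [br defBr] := b_neq0 r; split=> //.
have [S rS cS] := exists_indep_set r.
have [x [xr xS wx]] := exists_cocircuit rS cS.
have eq_d := eq_pencil x; move: (C^T *m x) xr xS wx eq_d => d dr dS wd eq_d.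
apply/matrixP => i j; rewrite {j}ord1.
pose w : 'cV[F]_R := \col_s (d s ord0 * (A i s - b0 s * A' i s)).
have : w = 0.
  apply: (@k_rank_max_vec _ _ _ B [set s | d s ord0 != 0]).
  - by rewrite -[X in (X <= _)%N]/(weight _); lia.
  - by move=> s; rewrite inE negbK mxE => /eqP ->; rewrite mul0r.
  apply/matrixP => k l; rewrite ord1 [RHS]mxE mxE.
  have := congr1 (fun M : 'M_(p, q) => M i k) eq_d; rewrite /= !pencilE.
  move/eqP; rewrite -subr_eq0 -sumrB => /eqP; apply: etrans; apply: eq_bigr => s _.
  have /matrixP/(_ k ord0) := (b_neq0 s).2; rewrite !mxE => ->.
  by ring.
move/matrixP/(_ r ord0); rewrite mxE dr mul1r [RHS]mxE => /eqP.
by rewrite subr_eq0 !mxE => /eqP.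
Qed.

End CommonThirdFactor.

(** * From equal tensors to unique factors *)

Section Uniqueness.
Variables (F : fieldType) (I J K : nat).

Lemma polyadic_pencil (R R' : nat)
  (A : 'M[F]_(I, R)) (B : 'M[F]_(J, R)) (C : 'M[F]_(K, R))
  (A' : 'M[F]_(I, R')) (B' : 'M[F]_(J, R')) (C' : 'M[F]_(K, R')) :
  polyadic A B C = polyadic A' B' C' -> forall x : 'cV[F]_K,
  A *m diag_mx (C^T *m x)^T *m B^T = A' *m diag_mx (C'^T *m x)^T *m B'^T.
Proof.
have slice S (X : 'M[F]_(I, S)) (Y : 'M[F]_(J, S)) (Z : 'M[F]_(K, S)) x i j :
    (X *m diag_mx (Z^T *m x)^T *m Y^T) i j =
    \sum_k x k ord0 * polyadic X Y Z (i, j, k).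
  rewrite pencilE; under [RHS]eq_bigr => k _ do rewrite sum_ffunE mulr_sumr.
  rewrite exchange_big; apply: eq_bigr => r _; rewrite mxE mulr_suml.
  by apply: eq_bigr => k _; rewrite ffunE !mxE /=; ring.
by move=> eqT x; apply/matrixP => i j; rewrite !slice eqT.
Qed.

(** [khatri_rao A B *m d] is the pencil written as a vector. *)
Lemma khatri_rao_pencil_eq0 (R : nat) (A : 'M[F]_(I, R)) (B : 'M[F]_(J, R))
  (d : 'cV[F]_R) :
  A *m diag_mx d^T *m B^T = 0 -> khatri_rao A B *m d = 0.
Proof.
move=> M0; apply/matrixP => ij k; rewrite ord1 [RHS]mxE mxE {k}.
case: (mxtens_indexP ij) => i j.
have /matrixP/(_ i j) := M0; rewrite pencilE [RHS]mxE; apply: etrans.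
apply: eq_bigr => r _.
by rewrite khatri_raoE mulrC.
Qed.

Variables (R : nat).
Variables (A : 'M[F]_(I, R)) (B : 'M[F]_(J, R)) (C : 'M[F]_(K, R)).
(** The form in which (ii) is used below; [R - \rank C + 1] is [m - 1]. *)
Hypothesis rank_weight : forall x : 'cV[F]_K,
  (\rank (A *m diag_mx (C^T *m x)^T *m B^T) <= R - \rank C + 1)%N ->
  (weight (C^T *m x)%R <= R - \rank C + 1)%N.
Hypothesis k_ranks : (maxn (minn (k_rank A) (k_rank B - 1))
  (minn (k_rank A - 1) (k_rank B)) + k_rank C >= R + 1)%N.
Hypothesis free_AB : \rank (khatri_rao A B) = R.

(** [R'] is kept free so that one argument serves both the minimality of [R] and the uniqueness of
    the third factor. *)
Lemma third_factor_unique (R' : nat)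
  (A' : 'M[F]_(I, R')) (B' : 'M[F]_(J, R')) (C' : 'M[F]_(K, R')) :
  (R' <= R)%N -> nonzero_cols C' -> polyadic A B C = polyadic A' B' C' ->
  R' = R /\ exists s : 'I_R' -> 'I_R, injective s /\
    forall j, exists2 a, a != 0 & col j C' = a *: col (s j) C.
Proof.
move=> leR'R C'0 eqT; have eq_pencil := polyadic_pencil eqT.
have kC := k_rank_le C; have kCr := k_rank_le_rank C.
have kA := k_rank_le A; have kB := k_rank_le B.
(* If [C'^T x = 0], the pencil at [x] is zero, and the full column rank of [khatri_rao A B] gives
   [C^T x = 0]. *)
have leCC' : (\rank C <= \rank C')%N.
  rewrite -mxrank_tr -[X in (_ <= X)%N]mxrank_tr mxrankS // submxE.
  apply/eqP/matrixP => i j; rewrite [RHS]mxE.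
  pose x := col j (cokermx C'^T).
  have C'x : C'^T *m x = 0.
    by rewrite mulmx_col mulmx_coker; apply/matrixP => a b; rewrite !mxE.
  have : khatri_rao A B *m (C^T *m x) = 0.
    apply: khatri_rao_pencil_eq0; rewrite eq_pencil C'x.
    by rewrite trmx0 linear0 mulmx0 mul0mx.
  move/(congr1 trmx); rewrite trmx_mul trmx0 => /eqP.
  rewrite mulmx_free_eq0 => [/eqP/matrixP/(_ ord0 i)|].
    by rewrite mxE mulmx_col [col _ _ _ _]mxE [RHS]mxE.
  by rewrite /row_free mxrank_tr free_AB.
(* The maximum in [k_ranks] is at most [R - 1], so [k_C >= 2], and both ranks are at least 2 as
   well. *)
have [||//||x|eqR [s [inj_s Cs]]] := @permutation_lemma F K R R' C^T C'^T.
- by rewrite trmxK; lia.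
- by rewrite mxrank_tr; lia.
- move=> j; rewrite -tr_col; apply: contraNneq (C'0 j) => e.
  by rewrite -[col j C']trmxK e trmx0.
(* The pencil has rank at most the weight of [C'^T x], hence at most [R - \rank C + 1]. By
   [rank_weight] the weight of [C^T x] is then small enough for [rank_pencil], and equals that
   rank. *)
- rewrite mxrank_tr => wx.
  have := rank_pencil_le A' B' (C'^T *m x); rewrite -eq_pencil => rM.
  have wd : (weight (C^T *m x)%R <= R - \rank C + 1)%N by apply: rank_weight; lia.
  by rewrite rank_pencil in rM => //; lia.
split=> //; exists s; split=> // j; have [a a0 Cj] := Cs j; exists a => //.
by apply: trmx_inj; rewrite linearZ /= !tr_col.
Qed.

(** The two terms of the maximum in [k_ranks] give two cases, exchanged by transposing the
    pencils. *)
Lemma common_third_factor_unique (A' : 'M[F]_(I, R)) (B' : 'M[F]_(J, R)) :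
  nonzero_cols A' -> nonzero_cols B' ->
  (forall x : 'cV[F]_K, A *m diag_mx (C^T *m x)^T *m B^T =
                        A' *m diag_mx (C^T *m x)^T *m B'^T) ->
  forall r, exists a b, [/\ a * b = 1, col r A' = a *: col r A
                          & col r B' = b *: col r B].
Proof.
move=> A'0 B'0 eq_pencil r.
have kC := k_rank_le C; have kA := k_rank_le A; have kB := k_rank_le B.
have [leAB|leBA] : (k_rank A + k_rank C >= R + 1 /\ k_rank B + k_rank C >= R + 2
   \/ k_rank B + k_rank C >= R + 1 /\ k_rank A + k_rank C >= R + 2)%N by lia.
  have [|||b [b0 defB defA]] := common_third_factor eq_pencil _ _ _ B'0 r; try lia.
  exists b^-1, b; split=> //; first by rewrite mulVf.
  by rewrite defA scalerA mulVf ?scale1r.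
have eq_pencilT x : B *m diag_mx (C^T *m x)^T *m A^T =
    B' *m diag_mx (C^T *m x)^T *m A'^T.
  have := eq_pencil x; move: (C^T *m x) => d eq_d; apply: trmx_inj.
  by rewrite !trmx_mul !trmxK !tr_diag_mx !mulmxA.
have [|||b [b0 defA defB]] := common_third_factor eq_pencilT _ _ _ A'0 r; try lia.
exists b, b^-1; split=> //; first by rewrite mulfV.
by rewrite defB scalerA mulVf ?scale1r.
Qed.

Lemma factors_unique
  (A' : 'M[F]_(I, R)) (B' : 'M[F]_(J, R)) (C' : 'M[F]_(K, R)) :
  is_polyadic (polyadic A B C) A' B' C' ->
  exists s : 'S_R, forall j, exists a b c,
    [/\ a * b * c = 1, col j A' = a *: col (s j) A,
        col j B' = b *: col (s j) B & col j C' = c *: col (s j) C].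
Proof.
case=> A'0 B'0 C'0 eqT.
have [_ [s0 [inj_s Cs]]] := third_factor_unique (leqnn R) C'0 eqT.
have [c Hc] := fin_all_exists (P := fun j c => c != 0 /\ col j C' = c *: col (s0 j) C)
  (fun j => let: ex_intro2 c c0 e := Cs j in ex_intro _ c (conj c0 e)).
pose s := perm inj_s.
(* The columns are reordered to match [C] and the scalars [c] are moved into the first factor, so
   that both decompositions have third factor [C]. *)
pose A2 := \matrix_(i, k) (c ((s^-1)%g k) * A' i ((s^-1)%g k)).
pose B2 := col_perm s^-1 B'.
have colA2 j : col (s j) A2 = c j *: col j A'.
  by apply/matrixP => i k; rewrite !mxE permK.
have colB2 j : col (s j) B2 = col j B'.
  by apply/matrixP => i k; rewrite !mxE permK.
have A20 : nonzero_cols A2.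
  move=> k; rewrite -(permKV s k) colA2 scaler_eq0 negb_or A'0.
  by case: (Hc ((s^-1)%g k)) => ->.
have B20 : nonzero_cols B2 by move=> k; rewrite -(permKV s k) colB2.
have eq_pencil (x : 'cV_K) : A *m diag_mx (C^T *m x)^T *m B^T =
    A2 *m diag_mx (C^T *m x)^T *m B2^T.
  rewrite (polyadic_pencil eqT); apply/matrixP => i j; rewrite !pencilE.
  rewrite [RHS](reindex_perm s); apply: eq_bigr => r _.
  have -> : A2 i (s r) = c r * A' i r by rewrite mxE permK.
  have -> : B2 j (s r) = B' j r by rewrite mxE permK.
  have -> : (C'^T *m x) r ord0 = c r * (C^T *m x) (s r) ord0.
    rewrite !mxE mulr_sumr; apply: eq_bigr => k _; rewrite !mxE.
    have /matrixP/(_ k ord0) := (Hc r).2; rewrite !mxE => ->.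
    by rewrite permE mulrA.
  by ring.
exists s => j.
have [a [b [ab1]]] := common_third_factor_unique A20 B20 eq_pencil (s j).
have [cj0 defC] := Hc j; rewrite colA2 colB2 => defA defB.
exists ((c j)^-1 * a), b, (c j); split.
- by rewrite mulrAC -[_ * a * _]mulrA [a * _]mulrC mulrA mulVf // mul1r.
- by rewrite -scalerA -defA scalerA mulVf ?scale1r.
- by [].
- by rewrite permE.
Qed.

Lemma polyadic_tensor_rank T : is_polyadic T A B C -> has_tensor_rank T R.
Proof.
move=> hT; split=> [|R' [A' [B' [C' [_ _ C'0 defT]]]]]; first by exists A, B, C.
have [_ _ _ defT0] := hT; have eqT := etrans (esym defT0) defT.
case: (leqP R' R) => [leR|/ltnW //].
by have [eqR _] := third_factor_unique leR C'0 eqT; rewrite eqR.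
Qed.

(** Permuting columns by [s] is right multiplication by [perm_mx s^-1], hence the inverse. *)
Lemma col_perm_scaleP (p : nat) (M M' : 'M[F]_(p, R)) (s : 'S_R) (l : 'I_R -> F) :
  (forall j, col j M' = l j *: col (s j) M) ->
  M' = M *m perm_mx s^-1 *m diag_mx (\row_j l j).
Proof.
move=> colM; rewrite -col_permE mul_mx_diag; apply/matrixP => i j.
by have /matrixP/(_ i ord0) := colM j; rewrite !mxE mulrC.
Qed.

(** Both decompositions are compared with [A], [B], [C]. The permutation between them is [s1^-1]
    after [s2], and the scalars are quotients. *)
Lemma polyadic_cpd_unique T : is_polyadic T A B C -> cpd_unique T.
Proof.
move=> hT R1 [hR1 minR1].
have [hR minR] := polyadic_tensor_rank hT.
have {hR1 minR1 hR minR} -> : R1 = R.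
  by apply/eqP; rewrite eqn_leq minR1 // minR.
move=> A1 A2 B1 B2 C1 C2; case: hT => _ _ _ ->.
move=> /factors_unique[s1 H1] /factors_unique[s2 H2].
pose s := (s2 * s1^-1)%g.
have /fin_all_exists[u Hu] : forall j, exists u : F * F * F,
    [/\ u.1.1 * u.1.2 * u.2 = 1, col j A2 = u.1.1 *: col (s j) A1,
        col j B2 = u.1.2 *: col (s j) B1 & col j C2 = u.2 *: col (s j) C1].
  move=> j; have [a2 [b2 [c2 [abc2 defA2 defB2 defC2]]]] := H2 j.
  have [a1 [b1 [c1 [abc1]]]] := H1 (s j).
  have -> : s1 (s j) = s2 j by rewrite permM permKV.
  move=> defA1 defB1 defC1.
  have : a1 * b1 * c1 != 0 by rewrite abc1 oner_neq0.
  rewrite !mulf_eq0 !negb_or => /andP[/andP[a10 b10] c10].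
  exists (a2 / a1, b2 / b1, c2 / c1) => /=.
  rewrite defA1 defB1 defC1 !scalerA !divfK // -defA2 -defB2 -defC2; split=> //.
  transitivity ((a2 * b2 * c2) / (a1 * b1 * c1)); last by rewrite abc1 abc2 divr1.
  by field; rewrite a10 b10 c10.
have unit_u j : [/\ (u j).1.1 != 0, (u j).1.2 != 0 & (u j).2 != 0].
  have [u1 _ _ _] := Hu j.
  have : (u j).1.1 * (u j).1.2 * (u j).2 != 0 by rewrite u1 oner_neq0.
  by rewrite !mulf_eq0 !negb_or => /andP[/andP[-> ->] ->].
have diag_unit (l : 'I_R -> F) : (forall j, l j != 0) ->
   diag_mx (\row_j l j) \in unitmx.
  move=> l0; rewrite unitmxE det_diag unitfE; apply/prodf_neq0 => j _.
  by rewrite mxE.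
exists s^-1%g, (\row_j (u j).1.1), (\row_j (u j).1.2), (\row_j (u j).2); split.
- by split; apply: diag_unit => j; case: (unit_u j).
- by apply: col_perm_scaleP => j; case: (Hu j).
- by apply: col_perm_scaleP => j; case: (Hu j).
- by apply: col_perm_scaleP => j; case: (Hu j).
apply/matrixP => i j; rewrite !mul_mx_diag !mxE.
case: eqP => [->|_]; last by rewrite !mul0r.
by rewrite !mulr1n; case: (Hu j).
Qed.

End Uniqueness.

Theorem proposition1p22 (RT : realType) (F : fieldType)
    (hF : real_or_complex RT F)
    (I J K R : nat) (T : tensor3 F I J K)
    (A : 'M[F]_(I, R)) (B : 'M[F]_(J, R)) (C : 'M[F]_(K, R))
    (hT : is_polyadic T A B C)
    (m : nat) (hm : m = (R - \rank C + 2)%N)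
    (h1 : (maxn (minn (k_rank A) (k_rank B - 1))
                (minn (k_rank A - 1) (k_rank B)) + k_rank C >= R + 1)%N)
    (hmA : (m <= minn I R)%N) (hmB : (m <= minn J R)%N)
    (h2 : forall d : 'cV[F]_R,
        (exists x : 'cV[F]_K, d = C^T *m x) ->
        khatri_rao (compound_mx m A) (compound_mx m B) *m hat_prod m d = 0 ->
        hat_prod m d = 0)
    (h3 : \rank (khatri_rao A B) = R) :
  has_tensor_rank T R /\ cpd_unique T.
Proof.
have rank_weight (x : 'cV[F]_K) :
    (\rank (A *m diag_mx (C^T *m x)^T *m B^T) <= R - \rank C + 1)%N ->
    (weight (C^T *m x)%R <= R - \rank C + 1)%N.
  move=> rM; rewrite -ltnS -addnS -hm.
  apply/hat_prod_eq0_weight/h2; first by exists x.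
  by apply: compound_hat_prod_eq0; rewrite hm addn2 ltnS (leq_trans rM) ?addn1.
split.
- exact: polyadic_tensor_rank rank_weight h1 h3 T hT.
- exact: polyadic_cpd_unique rank_weight h1 h3 T hT.
Qed.
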